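(* For any permutation rack $(X,\varphi)$ we have \begin{align*} \mathrm{HR}_0(X,\varphi)&\;\cong\;\mathbb{Z},\\ \mathrm{HR}_1(X,\varphi)&\;\cong\;\mathbb{Z}S\;\cong\;\mathbb{Z}^r,\\ \mathrm{HR}_2(X,\varphi)&\;\cong\;(\overline{\mathbb{Z}S}\otimes\mathbb{Z}S)\oplus\mathbb{Z}S_{\mathrm{fin}}\;\cong\;\mathbb{Z}^{r(r-1)+r_{\mathrm{fin}}}, \end{align*} where $S=X/\varphi$ is the set of orbits of $\varphi$, $r=|S|$ is its size, $S_{\mathrm{fin}}\subseteq S$ is the subset of finite orbits, and $|S_{\mathrm{fin}}|=r_{\mathrm{fin}}$ denotes its size.
   Context: A rack $(X,\rhd)$ is a set $X$ with a binary operation $\rhd$ such that every left multiplication $y\mapsto x\rhd y$ is a bijection and $x\rhd(y\rhd z)=(x\rhd y)\rhd(x\rhd z)$ for all $x,y,z\in X$. A permutation rack $(X,\varphi)$ is a set $X$ with a permutation $\varphi\colon X\to X$ and the rack operation $x\rhd y=\varphi(y)$. Rack homology: let $\mathrm{CR}_n(X,\varphi)=(\mathbb{Z}X)^{\otimes n}=\mathbb{Z}(X^n)$ for $n\geqslant 0$ (so $\mathrm{CR}_0=\mathbb{Z}$), with basis elements written as noncommutative monomials $x_1\cdots x_n$, and differential $\mathrm{d}\colon\mathrm{CR}_n\to\mathrm{CR}_{n-1}$, $$\mathrm{d}(x_1\cdots x_n)=\sum_{k=1}^{n-1}(-1)^{k-1}\bigl(x_1\cdots x_{k-1}x_{k+1}\cdots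 x_n-x_1\cdots x_{k-1}\,\varphi(x_{k+1})\cdots\varphi(x_n)\bigr).$$ The rack homology $\mathrm{HR}_n(X,\varphi)$ is the $n$-th homology of this chain complex. For a set $S$, $\mathbb{Z}S$ is the free abelian group on $S$, and $\overline{\mathbb{Z}S}\subseteq\mathbb{Z}S$ is the subgroup of linear combinations whose coefficients add up to zero. For a cardinal $\kappa$, $\mathbb{Z}^\kappa$ denotes the free abelian group of rank $\kappa$ (with $r-1=r$ if $r$ is infinite). *)

(* Defs.v *)
From HB Require Import structures.
From mathcomp Require Import all_boot all_order all_algebra.
From mathcomp Require Import generic_quotient ring_quotient.
From mathcomp Require Import boolp classical_sets cardinality.
From mathcomp Require Import freeg.
From mathcomp Require Import zify.

Set Implicit Arguments.
Unset Strict Implicit.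
Unset Printing Implicit Defensive.

Import GRing.Theory.

Local Open Scope classical_set_scope.
Local Open Scope card_scope.
Local Open Scope ring_scope.

Section Kernel.
Variables (A B : zmodType) (f : {additive A -> B}).

Definition ker_pred : {pred A} := [pred x | f x == 0].

Fact ker_pred_zmod_closed : zmod_closed ker_pred.
Proof.
split=> [|x y]; rewrite !inE ?raddf0 // => /eqP fx /eqP fy.
by rewrite raddfB fx fy subr0.
Qed.

HB.instance Definition _ :=
  GRing.isZmodClosed.Build A ker_pred ker_pred_zmod_closed.

Definition kernel := {x : A | x \in ker_pred}.

HB.instance Definition _ := SubChoice.on kernel.
HB.instance Definition _ := [SubChoice_isSubZmodule of kernel by <:].
End Kernel.

Section Homology.
Variables (A B C : zmodType) (f : {additive A -> B}) (g : {additive B -> C}).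

Definition bound_pred : {pred kernel g} :=
  [pred z : kernel g | `[< exists x, f x = \val z >]].

Fact bound_pred_zmod_closed : zmod_closed bound_pred.
Proof.
split=> [|z t]; first by apply/asboolP; exists 0; rewrite !raddf0.
by move=> /asboolP[x fx] /asboolP[y fy]; apply/asboolP; exists (x - y);
  rewrite !raddfB fx fy.
Qed.

HB.instance Definition _ :=
  GRing.isZmodClosed.Build (kernel g) bound_pred bound_pred_zmod_closed.

(* Ker g / Im f at the middle term of A -> B -> C; the definition does not
   need g \o f = 0, see [boundaryK] for the complex it is applied to *)
Definition homology : zmodType := Quotient.quot bound_pred.
End Homology.

Section Tensor.
Variables (A B : zmodType).
Local Notation F := {freeg (A * B)%type}.

Definition bilinear_relation (u : F) : Prop :=
  (exists a a' b, u = << (a + a', b) >> - << (a, b) >> - << (a', b) >>) \/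
  (exists a b b', u = << (a, b + b') >> - << (a, b) >> - << (a, b') >>).

Definition bilinear_span : {pred F} := [pred u | `[< forall P : {pred F},
  zmod_closed P -> (forall v, bilinear_relation v -> v \in P) -> u \in P >]].

Fact bilinear_span_zmod_closed : zmod_closed bilinear_span.
Proof.
split=> [|u v /asboolP Pu /asboolP Pv]; apply/asboolP => P Pz Pr.
  by case: Pz.
by case: (Pz) => _; apply; [exact: Pu | exact: Pv].
Qed.

HB.instance Definition _ :=
  GRing.isZmodClosed.Build F bilinear_span bilinear_span_zmod_closed.

Definition tensor : zmodType := Quotient.quot bilinear_span.
End Tensor.

Definition zmod_iso (A B : zmodType) : Prop :=
  exists f : {additive A -> B}, bijective f.

Notation "A ≅ B" := (zmod_iso A B) (at level 70) : type_scope.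

Definition augmentation_kernel (S : choiceType) : zmodType :=
  kernel (@deg S : {additive {freeg S} -> int}).

Section RackComplex.
Variables (X : choiceType) (phi : X -> X).

Definition chain n : zmodType := {freeg (n.-tuple X)}.

(* delete the letter of index k (counted from 0), and apply phi to the letters
   after it if [twist]; index i of the new word comes from index i or i + 1 of
   the old one according to i < k or k <= i *)
Definition face n (twist : bool) (k : 'I_n) (x : n.-tuple X) : n.-1.-tuple X :=
  [tuple let y := tnth x (fintype.lift k i) in if twist && (k <= i)%N then phi y else y
  | i < n.-1].

(* x_1 ... x_n |-> \sum_(1 <= k <= n - 1) (-1)^(k - 1) (...), with k shifted to
   start from 0; the sum is empty for n = 0 and n = 1 *)
Definition boundary_word n (x : n.-tuple X) : {freeg (n.-1.-tuple X)} :=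
  \sum_(k < n | (k.+1 < n)%N)
    (-1) ^+ k *: (<< face false k x >> - << face true k x >>).

(* [chain 0.-1] is [chain 0], so [boundary 0] is the zero endomorphism of
   [chain 0]; it has the same kernel as the map to the zero group *)
Definition boundary n : chain n -> chain n.-1 := fglift (@boundary_word n).

Fact boundary_is_zmod_morphism n : zmod_morphism (@boundary n).
Proof. exact: lift_is_additive. Qed.

HB.instance Definition _ n := GRing.isZmodMorphism.Build
  (chain n) (chain n.-1) (@boundary n) (@boundary_is_zmod_morphism n).

Definition HR n : zmodType := homology (@boundary n.+1) (@boundary n).

(* the powers of phi with exponents n and - n, for bijective phi *)
Definition phi_orbit (x : X) : set X :=
  [set y | exists n, iter n phi x = y \/ iter n phi y = x].

Definition orbits : set (set X) := range phi_orbit.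

Definition finite_orbits : set (set X) := [set O | orbits O /\ finite_set O].
End RackComplex.

(* |J| = |I| - 1; no condition on J when I is empty, where |I| * |J| = 0 for
   every J *)
Definition card_pred (J I : Type) : Prop :=
  (infinite_set [set: I] -> [set: J] #= [set: I]) /\
  (finite_set [set: I] -> [set: I] !=set0 -> [set: option J] #= [set: I]).

Section BoundaryK.
Variables (X : choiceType) (phi : X -> X).

Let shift (b : bool) (k : nat) (f : nat -> X) (i : nat) : X :=
  if b && (k <= i)%N then phi (f (bump k i)) else f (bump k i).

Let shift_comm b c j k f : (j <= k)%N ->
  shift b j (shift c k.+1 f) =1 shift c k (shift b j f).
Proof.
move=> jk i; rewrite /shift.
have -> : bump j (bump k i) = bump k.+1 (bump j i).
  by rewrite /bump; lia.
have -> : (k.+1 <= bump j i)%N = (k <= i)%N by rewrite /bump; lia.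
have -> : b && (j <= bump k i)%N = b && (j <= i)%N.
  by congr (_ && _); rewrite /bump; lia.
by case: (b && _); case: (c && _).
Qed.

Let word m (f : nat -> X) : m.-tuple X := [tuple f i | i < m].

Let face_word m b (k : 'I_m) f : face phi b k (word m f) = word m.-1 (shift b k f).
Proof. by apply: eq_from_tnth => i; rewrite !tnth_mktuple. Qed.

Let wordE m (x : m.+1.-tuple X) : x = word m.+1 (nth (thead x) x).
Proof. by apply: eq_from_tnth => i; rewrite tnth_mktuple (tnth_nth (thead x)). Qed.

Let antisym_sum (V : zmodType) m (a : nat -> nat -> V) :
  (forall j k, (j <= k)%N -> a j k.+1 = - a k j) ->
  \sum_(k < m.+1) \sum_(j < m) a j k = 0.
Proof.
move=> aN.
transitivity (\sum_(k < m.+1) \sum_(j < m | (j < k)%N) a j k +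
              \sum_(k < m.+1) \sum_(j < m | (k <= j)%N) a j k).
  rewrite -big_split /=; apply: eq_bigr => k _.
  rewrite (bigID (fun j : 'I_m => (j < k)%N)) /=; congr (_ + _).
  by apply: eq_bigl => j; rewrite -leqNgt.
rewrite big_ord_recl /= big1 ?add0r; last by move=> j; rewrite ltn0.
rewrite [X in _ + X]big_ord_recr /= [X in _ + (_ + X)]big1 ?addr0; last first.
  by move=> j /=; rewrite leqNgt ltn_ord.
rewrite [X in _ + X](exchange_big_dep predT) //= -big_split /= big1 // => k _.
rewrite (eq_bigr (fun j : 'I_m => - a k j)) ?sumrN ?addNr // => j jk.
by rewrite /bump /= add1n aN.
Qed.

Let boundary_wordE m f : boundary_word phi (word m.+1 f) =
  \sum_(k < m) (-1) ^+ k *: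
    (<< word m (shift false k f) >> - << word m (shift true k f) >>).
Proof.
rewrite /boundary_word big_mkcond big_ord_recr /= ltnn addr0.
by apply: eq_bigr => k _; rewrite ltnS ltn_ord !face_word.
Qed.

Fact boundaryK n (u : chain X n.+1) : boundary phi (boundary phi u) = 0.
Proof.
have bZ m (c : int) (v : chain X m) : boundary phi (c *: v) = c *: boundary phi v.
  by rewrite -[c]intz !scaler_int raddfMz.
have bU m (x : m.-tuple X) : boundary phi << x >> = boundary_word phi x.
  by rewrite /boundary liftU scale1r.
rewrite -[u]freeg_sumE !raddf_sum big1 //= => x _.
have -> : << coeff x u *g x >> = coeff x u *: << x >> :> chain X n.+1.
  by apply/eqP/freeg_eqP => y; rewrite coeffZ !coeffU mul1r.
suff wK : boundary phi (boundary_word phi x) = 0 by rewrite !bZ bU wK scaler0.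
case: n u x => [|m] u x; first by rewrite /boundary_word big_pred0 ?raddf0 //; case.
rewrite [x]wordE; set f := nth _ _; rewrite boundary_wordE raddf_sum /=.
pose a j k : chain X m := (-1) ^+ (j + k) *:
  (<< word m (shift false j (shift false k f)) >>
   - << word m (shift true j (shift false k f)) >>
   - (<< word m (shift false j (shift true k f)) >>
   - << word m (shift true j (shift true k f)) >>)).
rewrite -[RHS](@antisym_sum _ m a) => [|j k jk]; last first.
  have w b c : word m (shift b j (shift c k.+1 f)) = word m (shift c k (shift b j f)).
    by apply: eq_from_tnth => i; rewrite !tnth_mktuple shift_comm.
  rewrite /a !w addnS addnC exprS mulN1r scaleNr; congr (- (_ *: _)).
  by rewrite !opprB addrACA [- _ + _]addrC [RHS]addrACA; congr (_ + _); rewrite addrC.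
apply: eq_bigr => k _; rewrite bZ raddfB /= !bU !boundary_wordE -sumrB scaler_sumr.
by apply: eq_bigr => j _; rewrite /a -scalerBr scalerA -exprD addnC.
Qed.
End BoundaryK.

Fact card_pred_ex (I : choiceType) : exists J : choiceType, card_pred J I.
Proof.
have [fI|fI] := pselect (finite_set [set: I]); last first.
  by exists I; split=> // fI'; case: fI.
have [n In] := fI; exists ('I_n.-1 : choiceType); split=> // _ [x _].
case: n In => [|n] In.
  by move: In; rewrite II0 card_eq0 => /eqP/seteqP[/(_ x Logic.I)].
have oI : [set: option 'I_n] #= [set: 'I_n.+1].
  pose f (o : option 'I_n) := if o is Some i then fintype.lift ord0 i else ord0.
  have <- : f @` [set: option 'I_n] = [set: 'I_n.+1].
    apply/seteqP; split=> // j _.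
    by case: (unliftP ord0 j) => [i ->|->]; [exists (Some i) | exists None].
  apply/card_esym/inj_card_eq => -[i|] [j|] _ _ //= e.
  by rewrite (lift_inj e).
apply: card_eq_trans oI _; apply: card_eq_trans (card_esym card_II) _.
exact: card_esym.
Qed.

(* Main.v *)
(* In degree 2, let B be the group of boundaries. Subtracting d(xyz) from d(x'yz)
   shows that xz - x'z modulo B depends only on the orbit of z, and
   d(yyz) = y phi(z) - phi(y) phi(z) shows that xz modulo B depends only on the
   orbit of x and on z. Fix a base point x0. Modulo B, every chain u is then the
   sum of a combination of x_p y_s - x0 y_s, with x_p and y_s representatives of
   orbits, and of x0 v, where v forgets the first letters of u. If u is a cycle,
   then v is fixed by phi, so it is a combination of sums over finite orbits, and
   its coefficients can be read off at one chosen point of each finite orbit. *)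
Require Import Defs.
From HB Require Import structures.
From mathcomp Require Import all_boot all_order all_algebra.
From mathcomp Require Import generic_quotient ring_quotient.
From mathcomp Require Import boolp classical_sets functions cardinality.
From mathcomp Require Import freeg.

Import GRing.Theory.

Local Open Scope classical_set_scope.
Local Open Scope card_scope.
Local Open Scope ring_scope.

Set Implicit Arguments.
Unset Strict Implicit.
Unset Printing Implicit Defensive.

(** * Free abelian groups and their isomorphisms *)

HB.instance Definition _ (K : choiceType) (M : lmodType int) (f : K -> M) :=
  GRing.isZmodMorphism.Build {freeg K} M (fglift f) (lift_is_additive f).

Lemma fgliftE (K : choiceType) (M : lmodType int) (f : K -> M) x :
  fglift f << x >> = f x.
Proof. by rewrite liftU scale1r. Qed.

(** Sums, negatives and integer multiples all come from 0 and subtraction. The step is stated for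
    [u - v] so that [raddfB] alone settles it for additive maps. *)
Lemma freeg_ind (K : choiceType) (P : {freeg K} -> Prop) :
    P 0 -> (forall u v, P u -> P v -> P (u - v)) -> (forall x, P << x >>) ->
  forall u, P u.
Proof.
move=> P0 PB PU u.
have PN v : P v -> P (- v) by move=> Pv; rewrite -[- v]add0r; apply: PB.
have PD v w : P v -> P w -> P (v + w).
  by move=> Pv Pw; rewrite -[w]opprK; apply: PB => //; apply: PN.
have PMn v n : P v -> P (v *+ n).
  by move=> Pv; elim: n => [|n IH]; rewrite ?mulr0n // mulrS; apply: PD.
rewrite -[u]freeg_sumE; elim/big_ind: _ => // x _.
have -> : << coeff x u *g x >> = << x >> *~ coeff x u by rewrite freegU_mulz intz.
case: (coeff x u) => n; first exact: PMn.
by rewrite NegzE mulrNz; apply: PN; apply: PMn.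
Qed.

Lemma freeg_additive_ext (K : choiceType) (M : zmodType)
    (f g : {additive {freeg K} -> M}) :
  (forall x, f << x >> = g << x >>) -> f =1 g.
Proof.
move=> fg; apply: freeg_ind => [|u v fgu fgv|//]; first by rewrite !raddf0.
by rewrite !raddfB fgu fgv.
Qed.

Lemma zmod_iso_sym (A B : zmodType) : A ≅ B -> B ≅ A.
Proof.
move=> [f [g fK gK]].
have gB : zmod_morphism g by move=> x y; apply: (canLR fK); rewrite raddfB !gK.
pose G : {additive B -> A} :=
  HB.pack g (GRing.isZmodMorphism.Build B A g gB).
by exists G; exists f.
Qed.

Lemma zmod_iso_trans (A B C : zmodType) : A ≅ B -> B ≅ C -> A ≅ C.
Proof. by move=> [f fb] [g gb]; exists (g \o f); apply: bij_comp. Qed.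

Lemma zmod_iso_prod (A A' B B' : zmodType) :
  A ≅ A' -> B ≅ B' -> (A * B)%type ≅ (A' * B')%type.
Proof.
move=> [f [f' fK f'K]] [g [g' gK g'K]].
pose h (u : A * B) : A' * B' := (f u.1, g u.2).
have hB : zmod_morphism h by move=> u v; rewrite /h !raddfB.
pose H : {additive (A * B)%type -> (A' * B')%type} :=
  HB.pack h (GRing.isZmodMorphism.Build _ _ h hB).
by exists H; exists (fun u => (f' u.1, g' u.2)) => -[u v];
  rewrite /= /h /= ?fK ?gK ?f'K ?g'K.
Qed.

Lemma zmod_iso_freeg_bij (K L : choiceType) (f : K -> L) :
  bijective f -> {freeg K} ≅ {freeg L}.
Proof.
move=> [g fK gK]; exists (fglift (fun x => << f x >>)).
exists (fglift (fun x => << g x >>)).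
  by apply: (@freeg_additive_ext _ _ (fglift _ \o fglift _) idfun) => x /=;
    rewrite !fgliftE fK.
by apply: (@freeg_additive_ext _ _ (fglift _ \o fglift _) idfun) => x /=;
  rewrite !fgliftE gK.
Qed.

Lemma zmod_iso_freeg_sum (K L : choiceType) :
  ({freeg K} * {freeg L})%type ≅ {freeg (K + L)%type}.
Proof.
apply: zmod_iso_sym.
pose f (z : K + L) : {freeg K} * {freeg L} :=
  match z with inl x => (<< x >>, 0) | inr y => (0, << y >>) end.
exists (fglift f).
exists (fun u => fglift (fun x => << inl x >>) u.1
  + fglift (fun y => << inr y >>) u.2 : {freeg (K + L)%type}).
  apply: freeg_ind => [|u v uK vK|[x|y]]; rewrite ?raddf0 ?addr0 //.
  - by rewrite raddfB /= !raddfB /= addrACA -opprD uK vK.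
  - by rewrite /= fgliftE /= fgliftE raddf0 addr0.
  - by rewrite /= fgliftE /= fgliftE raddf0 add0r.
case=> u v /=; rewrite raddfD /=.
have -> : (u, v) = (u, 0) + (0, v).
  by rewrite /GRing.add /=; congr pair; rewrite ?addr0 ?add0r.
congr (_ + _).
  elim/freeg_ind: u => [|x y IHx IHy|x]; first by rewrite !raddf0.
    by rewrite !raddfB /= IHx IHy; congr pair; rewrite subr0.
  by rewrite !fgliftE.
elim/freeg_ind: v => [|x y IHx IHy|x]; first by rewrite !raddf0.
  by rewrite !raddfB /= IHx IHy; congr pair; rewrite subr0.
by rewrite !fgliftE.
Qed.

(** * Quotients and homology groups *)

Lemma quot_iso (V M : zmodType) (P : zmodClosed V)
    (h : {additive V -> M}) (s : M -> V) :
    {in P, forall z, h z = 0} -> cancel s h -> (forall z, z - s (h z) \in P) ->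
  Quotient.quot P ≅ M.
Proof.
move=> hP sK hs; pose q := (\pi_(Quotient.quot P))%qT.
have qE z t : q z = q t <-> z - t \in P.
  by rewrite Quotient.idealrBE; split=> [/eqP|/eqP].
(* Since [h] kills [P], its value at the chosen representative depends on the class only; [kq]
   records this. *)
pose k (z : Quotient.quot P) := h (repr z).
have kq z : k (q z) = h z.
  apply/eqP; rewrite -subr_eq0 -raddfB; apply/eqP/hP/qE.
  exact: reprK.
have kB : zmod_morphism k.
  by move=> x y; rewrite -[x]reprK -[y]reprK -raddfB -!/(q _) !kq raddfB.
pose H : {additive Quotient.quot P -> M} :=
  HB.pack k (GRing.isZmodMorphism.Build _ _ k kB).
exists H; exists (q \o s) => [x|m] /=; last by rewrite kq sK.
by rewrite -[x]reprK -/(q _) kq; apply/esym/qE; apply: hs.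
Qed.

(** The map [h] lives on all of [B], where it can be defined on basis elements; its restriction to
    cycles induces the isomorphism. [s] picks a cycle in each class. *)
Lemma homology_iso (A B C M : zmodType) (f : {additive A -> B})
    (g : {additive B -> C}) (h : {additive B -> M}) (s : M -> B) :
    (forall m, g (s m) = 0) -> cancel s h -> (forall a, h (f a) = 0) ->
    (forall b, g b = 0 -> exists a, f a = b - s (h b)) ->
  homology f g ≅ M.
Proof.
move=> gs sK hf hs.
have sP m : s m \in ker_pred g by rewrite inE gs.
pose hv : {additive kernel g -> M} := h \o \val.
apply: (@quot_iso _ _ (@bound_pred _ _ _ f g) hv
    (fun m => exist _ (s m) (sP m))) => //.
  by move=> z /asboolP[a fa]; rewrite /= -fa hf.
move=> z; apply/asboolP; have /eqP/hs[a fa] := valP z.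
by exists a; rewrite fa.
Qed.

Lemma homology_trivial (A B C M : zmodType) (f : {additive A -> B})
    (g : {additive B -> C}) :
  (forall b : B, b = 0) -> (forall m : M, m = 0) -> homology f g ≅ M.
Proof.
move=> B0 M0; apply: (@homology_iso _ _ _ _ _ _ \0 (fun=> 0)) => //.
- by move=> m; rewrite raddf0.
- by move=> b _; exists 0; rewrite [LHS]B0 [RHS]B0.
Qed.

Lemma subrACA (V : zmodType) (a b c d : V) : a - b - (c - d) = a - c - (b - d).
Proof. by rewrite !opprB addrACA [RHS]addrACA; congr (_ + _); rewrite addrC. Qed.

Lemma coeff1 (K : choiceType) (x y : K) : coeff y (<< x >> : {freeg K}) = (x == y)%:R.
Proof. by rewrite coeffU mul1r. Qed.

(** * Tensor products and augmentation kernels as free groups *)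

Lemma tensor_freeg (A B : zmodType) (I J : choiceType) :
  A ≅ {freeg I} -> B ≅ {freeg J} -> tensor A B ≅ {freeg (I * J)%type}.
Proof.
move=> /zmod_iso_sym[f [f' fK f'K]] /zmod_iso_sym[g [g' gK g'K]].
pose row u j : {freeg (I * J)%type} := fglift (fun i => << (i, j) >>) u.
(* The bilinear map that sends a pair of basis elements i, j to the basis element (i, j). *)
pose m u v : {freeg (I * J)%type} := fglift (row u) v.
have mBr u v w : m u (v - w) = m u v - m u w by rewrite /m raddfB.
have m0r u : m u 0 = 0 by rewrite /m raddf0.
have mBl u v w : m (u - v) w = m u w - m v w.
  elim/freeg_ind: w => [|x y IHx IHy|j]; first by rewrite !m0r subr0.
    by rewrite !mBr IHx IHy subrACA.
  by rewrite /m !fgliftE /row raddfB.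
have m0l v : m 0 v = 0 by rewrite -(subrr 0) mBl subrr.
have mDr u v w : m u (v + w) = m u v + m u w by rewrite /m raddfD.
have mDl u v w : m (u + v) w = m u w + m v w.
  by rewrite -{1}[v]opprK mBl -[- v]add0r mBl m0l sub0r opprK.
have mU i j : m << i >> << j >> = << (i, j) >> by rewrite /m fgliftE /row fgliftE.
have f'D x y : f' (x + y) = f' x + f' y by apply: (canLR fK); rewrite raddfD !f'K.
have g'D x y : g' (x + y) = g' x + g' y by apply: (canLR gK); rewrite raddfD !g'K.
pose h : {additive {freeg (A * B)%type} -> {freeg (I * J)%type}} :=
  fglift (fun z : A * B => m (f' z.1) (g' z.2)).
pose s : {additive {freeg (I * J)%type} -> {freeg (A * B)%type}} :=
  fglift (fun z : I * J => << (f << z.1 >>, g << z.2 >>) >>).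
have hP : {in @bilinear_span A B, forall z, h z = 0}.
  (* The span lies in every subgroup that contains the relations, in particular in the kernel of
     [h]; this leaves the two kinds of relations. *)
  move=> z /asboolP/(_ (ker_pred h))/(_ (ker_pred_zmod_closed h)) hz.
  apply/eqP; apply: hz => v [[a [a' [b ->]]]|[a [b [b' ->]]]];
    rewrite inE !raddfB /= !fgliftE /= ?f'D ?g'D ?mDl ?mDr;
    by rewrite -addrA -opprD subrr.
have sK : cancel s h.
  apply: (@freeg_additive_ext _ _ (h \o s) idfun) => -[i j].
  by rewrite /= !fgliftE /= fK gK mU.
apply: (@quot_iso _ _ (@bilinear_span A B) h s) => // z.
(* The claim left amounts to [q] being equal to [q \o (s \o h)]. Both are additive, so generators
   suffice, and there [pureE] gives it by bilinearity of [pure]. *)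
pose q : {additive {freeg (A * B)%type} -> tensor A B} := (\pi_(tensor A B))%qT.
pose pure a b := q << (a, b) >>.
have q0 v : bilinear_relation v -> q v = 0.
  move=> rv; rewrite -(raddf0 q); apply/eqP; rewrite -Quotient.idealrBE subr0.
  by apply/asboolP => Q _; apply.
have pureBl a b c : pure (a - b) c = pure a c - pure b c.
  apply/eqP; rewrite eq_sym subr_eq -subr_eq0 opprD addrA -!raddfB q0 //.
  by left; exists (a - b), b, c; rewrite subrK.
have pureBr a b c : pure a (b - c) = pure a b - pure a c.
  apply/eqP; rewrite eq_sym subr_eq -subr_eq0 opprD addrA -!raddfB q0 //.
  by right; exists a, (b - c), c; rewrite subrK.
have pure0l b : pure 0 b = 0 by rewrite -(subrr 0) pureBl subrr.
have pure0r a : pure a 0 = 0 by rewrite -(subrr 0) pureBr subrr.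
have pureE u v : pure (f u) (g v) = q (s (m u v)).
  elim/freeg_ind: u => [|u u' IHu IHu'|i]; first by rewrite m0l !raddf0 pure0l.
    by rewrite mBl !raddfB pureBl IHu IHu'.
  elim/freeg_ind: v => [|v v' IHv IHv'|j]; first by rewrite m0r !raddf0 pure0r.
    by rewrite mBr !raddfB pureBr IHv IHv'.
  by rewrite mU /= fgliftE.
rewrite Quotient.idealrBE; apply/eqP; rewrite -![(\pi _)%qT]/(q _).
move: z; apply: (@freeg_additive_ext _ _ q (q \o (s \o h))) => -[a b].
by rewrite /= [fglift _ << _ >>]fgliftE /= -pureE f'K g'K.
Qed.

(** The differences from the base point [e None] form a basis: by [shE], expressing [u] through them
    leaves the error [deg u] times the base point, which is zero on the kernel. *)
Lemma augmentation_kernel_freeg (S P : choiceType) (e : option P -> S) :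
  bijective e -> augmentation_kernel S ≅ {freeg P}.
Proof.
move=> [e' eK e'K]; apply: zmod_iso_sym.
pose s : {additive {freeg P} -> {freeg S}} :=
  fglift (fun p => << e (Some p) >> - << e None >>).
pose h : {additive {freeg S} -> {freeg P}} :=
  fglift (fun x => if e' x is Some p then << p >> else 0).
have sP u : s u \in ker_pred (@deg S : {additive {freeg S} -> int}).
  rewrite inE; apply/eqP.
  apply: (@freeg_additive_ext _ _ ((@deg S : {additive {freeg S} -> int}) \o s) \0) => p.
  by rewrite /= fgliftE raddfB /= !degU subrr.
have hsK : cancel s h.
  apply: (@freeg_additive_ext _ _ (h \o s) idfun) => p.
  by rewrite /= fgliftE raddfB /= !fgliftE !eK subr0.
have shE u : s (h u) = u - << e None >> *~ deg u.
  elim/freeg_ind: u => [|u v IHu IHv|x].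
  - by rewrite deg0 mulr0z !raddf0 addr0.
  - by rewrite degB [h _]raddfB [s _]raddfB IHu IHv mulrzBr subrACA.
  - rewrite degU mulr1z /= fgliftE -{2}[x]e'K.
    by case: (e' x) => [p|]; rewrite ?fgliftE // raddf0 subrr.
pose k u : kernel (@deg S : {additive {freeg S} -> int}) := exist _ (s u) (sP u).
have kB : zmod_morphism k by move=> u v; apply: val_inj; rewrite /= raddfB.
pose K : {additive {freeg P} -> kernel (@deg S : {additive {freeg S} -> int})} :=
  HB.pack k (GRing.isZmodMorphism.Build _ _ k kB).
exists K; exists (h \o \val) => [u|z] /=; first by rewrite hsK.
have z0 : deg (\val z) = 0 by apply/eqP/(valP z).
by apply: val_inj; rewrite /= shE z0 mulr0z subr0.
Qed.

(** * Image subgroups and orbits *)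

Definition image_pred (A B : zmodType) (f : {additive A -> B}) : {pred B} :=
  [pred u | `[< exists a, f a = u >]].

Fact image_pred_zmod_closed (A B : zmodType) (f : {additive A -> B}) :
  zmod_closed (image_pred f).
Proof.
split=> [|u v]; first by apply/asboolP; exists 0; rewrite raddf0.
by move=> /asboolP[a <-] /asboolP[b <-]; apply/asboolP; exists (a - b); rewrite raddfB.
Qed.

(** Lets congruences modulo boundaries be combined with [rpredB], [rpredD] and [rpredN], without
    tracking preimages. *)
HB.instance Definition _ (A B : zmodType) (f : {additive A -> B}) :=
  GRing.isZmodClosed.Build B (image_pred f) (image_pred_zmod_closed f).

Lemma image_predP (A B : zmodType) (f : {additive A -> B}) u :
  reflect (exists a, f a = u) (u \in image_pred f).
Proof. exact: asboolP. Qed.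

Lemma phi_orbit_phi (X : choiceType) (phi : X -> X) x :
  injective phi -> phi_orbit phi (phi x) = phi_orbit phi x.
Proof.
move=> phi_inj; apply/seteqP; split=> y /= [n [nE|nE]].
- by exists n.+1; left; rewrite iterSr.
- case: n nE => [|n] /= nE; first by exists 1; left.
  by exists n; right; apply: phi_inj.
- case: n nE => [|n] nE; first by exists 1; right; rewrite /= -nE.
  by exists n; left; rewrite -iterSr.
- by exists n.+1; right; rewrite /= nE.
Qed.

Definition orbit_class (X : choiceType) (phi : X -> X) (x : X) : orbits phi :=
  exist _ (phi_orbit phi x) (mem_set (imageT (phi_orbit phi) x)).

Lemma orbit_class_phi (X : choiceType) (phi : X -> X) x :
  injective phi -> orbit_class phi (phi x) = orbit_class phi x.
Proof. by move=> phi_inj; apply: val_inj; apply: phi_orbit_phi. Qed.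

Lemma orbit_class_surj (X : choiceType) (phi : X -> X) (s : orbits phi) :
  exists x, orbit_class phi x = s.
Proof. by have [x _ xs] := set_mem (valP s); exists x; apply: val_inj. Qed.

(** Being in the same orbit is the least equivalence relation that relates each x to phi(x). This
    transports along orbits both congruence modulo boundaries and equality of coefficients. *)
Lemma orbit_class_rel (X : choiceType) (phi : X -> X) (R : X -> X -> Prop) :
    (forall x, R x x) -> (forall x y, R x y -> R y x) ->
    (forall x y z, R x y -> R y z -> R x z) -> (forall x, R x (phi x)) ->
  forall x y, orbit_class phi x = orbit_class phi y -> R x y.
Proof.
move=> Rr Rs Rt Rphi x y /(congr1 val)/= xy.
have Rn n z : R z (iter n phi z) by elim: n => //= n /Rt; apply.
have : phi_orbit phi x y by rewrite xy; exists 0; left.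
by case=> n [<-//|<-]; apply: Rs.
Qed.

(** * Boundaries in low degrees, and homology in degrees 0 and 1 *)

Lemma boundary0 (X : choiceType) (phi : X -> X) (u : chain X 0) :
  boundary phi u = 0.
Proof.
apply: (@freeg_additive_ext _ _ (@boundary X phi 0) \0) => x.
by rewrite /= /boundary fgliftE /boundary_word big_pred0.
Qed.

Lemma boundary1 (X : choiceType) (phi : X -> X) (u : chain X 1) :
  boundary phi u = 0.
Proof.
apply: (@freeg_additive_ext _ _ (@boundary X phi 1) \0) => x.
by rewrite /= /boundary fgliftE /boundary_word big_pred0 // => k; rewrite ltnS ltn0.
Qed.

Lemma boundary2 (X : choiceType) (phi : X -> X) (x y : X) :
  boundary phi (<< [tuple x; y] >> : chain X 2) =
  << [tuple y] >> - << [tuple phi y] >> :> chain X 1.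
Proof.
rewrite /boundary fgliftE /boundary_word big_mkcond !big_ord_recl big_ord0 /=.
rewrite !addr0 expr0 scale1r.
by congr (<< _ >> - << _ >>); apply: eq_from_tnth => i;
  rewrite tnth_mktuple /= [i]ord1 !(tnth_nth x).
Qed.

Lemma boundary3 (X : choiceType) (phi : X -> X) (x y z : X) :
  boundary phi (<< [tuple x; y; z] >> : chain X 3) =
  << [tuple y; z] >> - << [tuple phi y; phi z] >>
  - (<< [tuple x; z] >> - << [tuple x; phi z] >>) :> chain X 2.
Proof.
rewrite /boundary fgliftE /boundary_word big_mkcond !big_ord_recl big_ord0 /=.
rewrite !addr0 expr0 scale1r expr1 scaleN1r.
by congr (<< _ >> - << _ >> - (<< _ >> - << _ >>)); apply: eq_from_tnth => i;
  rewrite tnth_mktuple /= !(tnth_nth x); case: i => -[|[|]].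
Qed.

(** The empty word is the only basis element and both differentials vanish, so the degree is already
    an isomorphism. *)
Lemma HR0_iso (X : choiceType) (phi : X -> X) : HR phi 0 ≅ int.
Proof.
apply: (@homology_iso _ _ _ _ _ _ (@deg (0.-tuple X)) (fun c => << c *g [tuple] >>)).
- by move=> c /=; rewrite boundary0.
- by move=> c; rewrite /= degU.
- by move=> u /=; rewrite boundary1 raddf0.
- move=> u _; exists 0; rewrite raddf0; apply/esym/eqP; rewrite subr_eq0; apply/eqP => /=.
  elim/freeg_ind: u => [|u v {1}-> {1}->|x].
  + by rewrite deg0 freegU0.
  + by rewrite freegUB degB.
  + by rewrite degU [x]tuple0.
Qed.

(** Every 1-chain is a cycle, and d(xy) = y - phi(y), so passing to homology identifies exactly the
    letters in a common orbit. *)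
Lemma HR1_iso (X : choiceType) (phi : X -> X) :
  injective phi -> HR phi 1 ≅ {freeg (orbits phi)}.
Proof.
move=> phi_inj; pose cls := orbit_class phi.
have [rep repK] := choice (@orbit_class_surj X phi).
pose h : {additive chain X 1 -> {freeg (orbits phi)}} :=
  fglift (fun t => << cls (thead t) >>).
pose s : {additive {freeg (orbits phi)} -> chain X 1} :=
  fglift (fun o => << [tuple rep o] >>).
have sK : cancel s h.
  apply: (@freeg_additive_ext _ _ (h \o s) idfun) => o.
  by rewrite /= !fgliftE theadE /cls repK.
have hb : forall u, h (@boundary X phi 2 u) = 0.
  apply: (@freeg_additive_ext _ _ (h \o @boundary X phi 2) \0).
  case/tupleP=> x t; case/tupleP: t => y t; rewrite [t]tuple0.
  by rewrite /= boundary2 raddfB /= !fgliftE !theadE /cls orbit_class_phi // subrr.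
apply: (@homology_iso _ _ _ _ (@boundary X phi 2) _ h s) => // [m|u _].
  by rewrite /= boundary1.
apply/image_predP; set B := image_pred _.
elim/freeg_ind: u => [|u v Bu Bv|t]; first by rewrite !raddf0 addr0 rpred0.
  by rewrite [h _]raddfB [s _]raddfB subrACA rpredB.
case/tupleP: t => x t; rewrite [t]tuple0 /= fgliftE /= fgliftE theadE.
apply: (@orbit_class_rel X phi
  (fun x y => << [tuple x] >> - << [tuple y] >> \in B)).
- by move=> y; rewrite subrr rpred0.
- by move=> y z; rewrite -opprB rpredN.
- by move=> y z w yz /(rpredD yz); rewrite addrA subrK.
- by move=> y; apply/image_predP; exists << [tuple y; y] >>; rewrite /= boundary2.
- by rewrite repK.
Qed.

(** * Homology in degree 2 *)

Lemma phi_orbitP (X : choiceType) (phi : X -> X) x y :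
  injective phi -> phi_orbit phi x y <-> phi_orbit phi y = phi_orbit phi x.
Proof.
move=> phi_inj; have iterE n z : phi_orbit phi (iter n phi z) = phi_orbit phi z.
  by elim: n => //= n; rewrite phi_orbit_phi.
split=> [[n [<-|<-]]|<-]; rewrite ?iterE //.
by exists 0; left.
Qed.

Lemma finite_orbit_enum (X : choiceType) (phi : X -> X) (o : finite_orbits phi) :
  injective phi ->
  exists t : seq X, uniq t /\ forall x, (x \in t) = `[< phi_orbit phi x = val o >].
Proof.
move=> phi_inj; have [[z _ <-] /finite_seqP[t tE]] := set_mem (valP o).
exists (undup t); split=> [|x]; first exact: undup_uniq.
rewrite mem_undup; apply/idP/asboolP => [xt|]; first by apply/phi_orbitP; rewrite // tE.
by move/phi_orbitP => /(_ phi_inj); rewrite tE.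
Qed.

(** Tells whether a point lies in the image of [f] and, if so, names its preimage. It serves for the
    chosen points of finite orbits and for a copy of [nat] in an infinite type. *)
Lemma injective_partial_inverse (Y : choiceType) (X : Type) (f : Y -> X) : injective f ->
  exists g : X -> option Y, pcancel f g /\ forall x y, g x = Some y -> f y = x.
Proof.
move=> f_inj.
have gE x : exists o : option Y, (forall y, o = Some y <-> f y = x).
  have [[y <-]|nE] := pselect (exists y, f y = x).
    by exists (Some y) => z; split=> [[->]|/f_inj->].
  by exists None => y; split=> // xE; case: nE; exists y.
have [g gP] := choice gE; exists g; split=> [y|x y]; first by apply/gP.
by move/gP.
Qed.

(** [e] singles out the base orbit [e None] and indexes the other orbits by [P]. *)
Lemma HR2_iso (X : choiceType) (phi : X -> X) (P : choiceType)
    (e : option P -> orbits phi) : bijective phi -> bijective e ->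
  HR phi 2 ≅ {freeg (P * orbits phi + finite_orbits phi)%type}.
Proof.
move=> phi_bij [e' eK e'K]; have phi_inj := bij_inj phi_bij.
pose cls := orbit_class phi.
have [rep repK] := choice (@orbit_class_surj X phi).
have [enum enumP] := choice (fun o => @finite_orbit_enum X phi o phi_inj).
have repfE (o : finite_orbits phi) : exists x, phi_orbit phi x = val o.
  by have [[x _ xo] _] := set_mem (valP o); exists x.
have [repf repfK] := choice repfE.
have repf_inj : injective repf.
  by move=> o o' oo'; apply: val_inj; rewrite -!repfK oo'.
have [unrep [unrepK unrepE]] := injective_partial_inverse repf_inj.
pose x0 := rep (e None).
pose M := {freeg (P * orbits phi + finite_orbits phi)%type}.
(* The value 0 on the base orbit reflects that xy - x0 y is a boundary when x lies in the orbit of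
   x0. *)
pose h1 (x y : X) : M := if e' (cls x) is Some p then << inl (p, cls y) >> else 0.
pose h2 (y : X) : M := if unrep y is Some o then << inr o >> else 0.
(* inl and inr receive the coordinates on the x_p y_s - x0 y_s and on the sums
   over finite orbits; only the chosen point repf o of o contributes to inr o *)
pose h : {additive chain X 2 -> M} :=
  fglift (fun t => h1 (tnth t ord0) (tnth t ord_max) + h2 (tnth t ord_max)).
have hE x y : h << [tuple x; y] >> = h1 x y + h2 y.
  by rewrite /= fgliftE.
pose s : {additive M -> chain X 2} := fglift (fun z => match z with
  | inl (p, o) => << [tuple rep (e (Some p)); rep o] >> - << [tuple x0; rep o] >>
  | inr o => \sum_(y <- enum o) << [tuple x0; y] >>
  end).
have h1_phir x y : h1 x (phi y) = h1 x y by rewrite /h1 /cls orbit_class_phi.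
have h1_phil x y : h1 (phi x) y = h1 x y by rewrite /h1 /cls orbit_class_phi.
have h1_x0 y : h1 x0 y = 0 by rewrite /h1 /cls repK eK.
have bs m : @boundary X phi 2 (s m) = 0.
  apply: (@freeg_additive_ext _ _ (@boundary X phi 2 \o s) \0) m => -[[p o]|o].
    by rewrite /= fgliftE raddfB /= !boundary2 subrr.
  have [o_uniq oE] := enumP o.
  rewrite /= fgliftE raddf_sum /=.
  under eq_bigr do rewrite boundary2.
  rewrite sumrB; apply/eqP; rewrite subr_eq0; apply/eqP.
  (* The boundary of an orbit sum is the orbit sum minus its image under [phi], and [phi] permutes
     the points of the orbit. *)
  rewrite -(big_map phi xpredT (fun y => << [tuple y] >>)).
  apply: perm_big; apply: uniq_perm => //; first by rewrite map_inj_uniq.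
  have mem_phi y : (phi y \in enum o) = (y \in enum o).
    by rewrite !oE phi_orbit_phi.
  move=> y; have [phi' _ phi'K] := phi_bij.
  by rewrite -[y]phi'K mem_phi mem_map.
have sK : cancel s h.
  apply: (@freeg_additive_ext _ _ (h \o s) idfun) => -[[p o]|o].
    rewrite /= fgliftE raddfB !hE h1_x0 /h1 /cls !repK eK.
    by rewrite add0r addrK.
  have [o_uniq oE] := enumP o.
  rewrite /= fgliftE raddf_sum.
  under eq_bigr do rewrite hE h1_x0 add0r.
  have repo : repf o \in enum o by rewrite oE repfK; apply/asboolP.
  (* Among the points of [enum o] only [repf o] contributes: a chosen point [repf o'] in the same
     orbit has [o' = o]. *)
  rewrite (big_rem _ repo) /= {1}/h2 unrepK big_seq big1 ?addr0 // => y.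
  rewrite mem_rem_uniq // inE => /andP[/eqP yo].
  rewrite oE /h2 => /asboolP oy.
  case Ey: (unrep y) => [o'|//]; case: yo; rewrite -(unrepE _ _ Ey); congr repf.
  by apply: val_inj; rewrite -oy -repfK (unrepE _ _ Ey).
(* As [h1] is invariant under [phi] in both arguments, each of the two differences in d(xyz)
   contributes [h2 z - h2 (phi z)], and these cancel. *)
have hb u : h (@boundary X phi 3 u) = 0.
  apply: (@freeg_additive_ext _ _ (h \o @boundary X phi 3) \0) u.
  case/tupleP=> x t; case/tupleP: t => y t; case/tupleP: t => z t; rewrite [t]tuple0.
  rewrite /= boundary3 ![h (_ - _)]raddfB !hE h1_phil !h1_phir.
  have aux (a b c : M) : a + b - (a + c) = b - c by rewrite opprD addrACA subrr add0r.
  by rewrite !aux subrr.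
pose B := image_pred (@boundary X phi 3).
have B1 x x' y : cls x = cls x' -> << [tuple x; y] >> - << [tuple x'; y] >> \in B.
  apply: (@orbit_class_rel X phi
    (fun x x' => << [tuple x; y] >> - << [tuple x'; y] >> \in B)).
  - by move=> z; rewrite subrr rpred0.
  - by move=> z t; rewrite -opprB rpredN.
  - by move=> z t w zt /(rpredD zt); rewrite addrA subrK.
  move=> z; have [phi' _ phi'K] := phi_bij; apply/image_predP.
  (* The last letter is [phi' y] so that the twisted faces end in [y]; the two untwisted faces agree
     because the first two letters do. *)
  exists << [tuple z; z; phi' y] >>.
  by rewrite /= boundary3 phi'K opprB addrC addrA subrK.
have B2 x x' y y' : cls y = cls y' ->
    << [tuple x; y] >> - << [tuple x'; y] >>
    - (<< [tuple x; y'] >> - << [tuple x'; y'] >>) \in B.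
  apply: (@orbit_class_rel X phi (fun y y' =>
    << [tuple x; y] >> - << [tuple x'; y] >>
    - (<< [tuple x; y'] >> - << [tuple x'; y'] >>) \in B)).
  - by move=> z; rewrite subrr rpred0.
  - by move=> z t; rewrite -opprB rpredN.
  - by move=> z t w zt /(rpredD zt); rewrite addrA subrK.
  move=> z; apply/image_predP.
  (* The faces that delete the first letter are common to both words and cancel. *)
  exists (<< [tuple x'; x; z] >> - << [tuple x; x; z] >>).
  by rewrite raddfB /= !boundary3 subrACA subrr sub0r opprB subrACA.
(* Unlike [s], this drops the [inr] coordinates: for a chain that need not be a cycle, the term
   [x0_ (v u)] accounts for all second letters. *)
pose s1 : {additive M -> chain X 2} := fglift (fun z => match z with
  | inl (p, o) => << [tuple rep (e (Some p)); rep o] >> - << [tuple x0; rep o] >>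
  | inr o => 0
  end).
pose v : {additive chain X 2 -> {freeg X}} :=
  fglift (fun t => << tnth t ord_max >>).
have vE x y : v << [tuple x; y] >> = << y >>.
  by rewrite /= fgliftE.
pose x0_ : {additive {freeg X} -> chain X 2} := fglift (fun y => << [tuple x0; y] >>).
have decomp u : u - s1 (h u) - x0_ (v u) \in B.
  elim/freeg_ind: u => [|u w Bu Bw|t]; first by rewrite !raddf0 !addr0 rpred0.
    rewrite [h _]raddfB [s1 _]raddfB [v _]raddfB [x0_ _]raddfB.
    by rewrite [X in X - (x0_ _ - _)]subrACA [X in X \in _]subrACA rpredB.
  case/tupleP: t => x t; case/tupleP: t => y t; rewrite [t]tuple0.
  rewrite hE vE raddfD [x0_ _]fgliftE.
  have -> : s1 (h2 y) = 0.
    by rewrite /h2; case: (unrep y) => [o|]; rewrite ?raddf0 //= fgliftE.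
  rewrite addr0 /h1; case Ex: (e' (cls x)) => [p|].
    rewrite [s1 _]fgliftE addrAC.
    have E (a b c d : chain X 2) : a - b - d = (a - c) + (c - b - d).
      by rewrite !addrA subrK.
    (* First [B1] moves x to its representative, then [B2] moves y to its representative in the
       difference from x0. *)
    rewrite (E _ _ << [tuple rep (e (Some p)); y] >>) rpredD //.
      by apply: B1; rewrite /cls repK -Ex e'K.
    by apply: B2; rewrite /cls repK.
  by rewrite raddf0 subr0; apply: B1; rewrite -[cls x]e'K Ex /cls repK.
(* Since d(xy) = y - phi(y), the boundary of [u] is [v u] minus its image under [phi]; this is its
   coefficient at [phi z]. *)
have coeff_v u z : coeff [tuple phi z] (@boundary X phi 2 u : chain X 1) =
    coeff (phi z) (v u) - coeff z (v u).
  elim/freeg_ind: u => [|u w IHu IHw|t]; first by rewrite !raddf0 subr0.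
    by rewrite [boundary _ _]raddfB [v _]raddfB !coeffB IHu IHw subrACA.
  case/tupleP: t => x t; case/tupleP: t => y t; rewrite [t]tuple0.
  rewrite boundary2 vE raddfB /= !coeff1.
  by rewrite -!val_eqE /= !eqseq_cons !andbT (inj_eq phi_inj).
have coeff_h u o : coeff (inr o) (h u) = coeff (repf o) (v u).
  elim/freeg_ind: u => [|u w IHu IHw|t]; first by rewrite !raddf0.
    by rewrite [h _]raddfB [v _]raddfB !coeffB IHu IHw.
  case/tupleP: t => x t; case/tupleP: t => y t; rewrite [t]tuple0.
  rewrite hE vE raddfD /= coeff1.
  have -> : coeff (inr o) (h1 x y) = 0.
    by rewrite /h1; case: (e' _) => [p|]; rewrite ?coeff0 ?coeff1.
  rewrite add0r /h2; case Ey: (unrep y) => [o'|].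
    by rewrite coeff1 -(unrepE _ _ Ey) (inj_eq repf_inj).
  rewrite coeff0; case: eqP => // yo; move: Ey; rewrite yo unrepK //.
apply: (@homology_iso _ _ _ _ (@boundary X phi 3) _ h s) => // u bu.
apply/image_predP; rewrite -/B.
(* This is a cycle killed by [h], so by [decomp] it is [x0_ (v w)] modulo boundaries, and it remains
   to show [v w = 0]. *)
set w := u - s (h u).
have bw : @boundary X phi 2 w = 0 by rewrite /w raddfB /= bs bu subrr.
have hw : h w = 0 by rewrite /w [LHS]raddfB sK subrr.
have := decomp w; rewrite hw raddf0 subr0.
suff -> : v w = 0 by rewrite raddf0 subr0.
have vphi z : coeff (phi z) (v w) = coeff z (v w).
  by apply/eqP; rewrite -subr_eq0 -coeff_v bw coeff0.
have v_orbit y z : phi_orbit phi y = phi_orbit phi z -> coeff y (v w) = coeff z (v w).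
  move=> yz; apply: (@orbit_class_rel X phi (fun y z => coeff y (v w) = coeff z (v w))).
  - by [].
  - by move=> ? ? ->.
  - by move=> ? ? ? -> ->.
  - by move=> t; rewrite vphi.
  - exact: val_inj.
apply/eqP/freeg_eqP => z; rewrite coeff0; apply/eqP/negPn/negP => nz.
(* The coefficients of [v w] are constant on orbits, so a nonzero one forces its orbit into the
   finite support. By [coeff_h] it is then a coordinate of [h w], which is zero. *)
have fin_z : finite_set (phi_orbit phi z).
  apply: (@sub_finite_set _ _ [set` dom (v w)]); last exact: finite_seq.
  by move=> y /phi_orbitP yz /=; rewrite mem_dom (v_orbit y z) // yz.
have zP : phi_orbit phi z \in finite_orbits phi.
  by apply/mem_set; split=> //; exists z.
pose o : finite_orbits phi := SigSub zP.
by move/negP: nz; apply; rewrite -(v_orbit (repf o)) ?repfK // -coeff_h hw coeff0.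
Qed.

(** * Cardinalities and bijections *)

Lemma card_eq_setT (T U : Type) :
  [set: T] #= [set: U] -> exists f : T -> U, bijective f.
Proof.
move=> /card_bijP[f [g fK gK]].
exists (fun x => \val (f (SigSub (mem_set (I : setT x))))).
exists (fun y => \val (g (SigSub (mem_set (I : setT y))))) => [x|y].
  set z := f _; rewrite (_ : SigSub _ = z); last exact: val_inj.
  by rewrite fK.
set z := g _; rewrite (_ : SigSub _ = z); last exact: val_inj.
by rewrite gK.
Qed.

(** Hilbert's hotel: the new point goes to the start of a copy of [nat], which shifts by one.
    Injectivity of this map is enough, by Cantor-Bernstein in the form [card_eq_le]. *)
Lemma card_eq_option (T : choiceType) :
  infinite_set [set: T] -> [set: option T] #= [set: T].
Proof.
move=> /infiniteP/card_leP[i0].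
have [i i_inj] : exists i : nat -> T, injective i.
  exists (fun n => \val (i0 (SigSub (mem_set (I : setT n))))) => m n /val_inj.
  by move=> /inj; rewrite !inE => /(_ I I)[].
have [idx [idxK idxE]] := injective_partial_inverse i_inj.
pose f (o : option T) :=
  if o is Some x then (if idx x is Some n then i n.+1 else x) else i 0%N.
have f_inj : injective f.
  move=> [x|] [y|] //=.
  - case Ex: (idx x) => [n|]; case Ey: (idx y) => [m|].
    + by move=> /i_inj[nm]; rewrite -(idxE _ _ Ex) -(idxE _ _ Ey) nm.
    + by move=> yE; rewrite -yE idxK in Ey.
    + by move=> xE; rewrite xE idxK in Ex.
    + by move=> ->.
  - case Ex: (idx x) => [n|]; first by move/i_inj.
    by move=> xE; rewrite xE idxK in Ex.
  - case Ey: (idx y) => [n|]; first by move/i_inj.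
    by move=> yE; rewrite -yE idxK in Ey.
rewrite card_eq_le; apply/andP; split.
  rewrite -(card_le_eql (inj_card_eq (in2W f_inj))); exact: card_leT.
rewrite -(card_le_eql (@card_some _ [set: T])); exact: card_leT.
Qed.

Lemma freeg_empty (K : choiceType) : (K -> False) -> forall u : {freeg K}, u = 0.
Proof. by move=> K0; elim/freeg_ind => [//|u v -> ->|x]; [rewrite subrr|case: K0]. Qed.

Lemma zmod_iso_trivial (A B : zmodType) :
  (forall a : A, a = 0) -> (forall b : B, b = 0) -> A ≅ B.
Proof.
by move=> A0 B0; exists \0; exists (fun=> 0) => x; [rewrite [RHS]A0|rewrite [RHS]B0].
Qed.

Theorem theoremC (X : choiceType) (phi : X -> X) (phi_bij : bijective phi)
    (r r_pred r_fin : choiceType)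
    (card_r : [set: r] #= orbits phi)
    (card_r_pred : card_pred r_pred r)
    (card_r_fin : [set: r_fin] #= finite_orbits phi) :
  let S : choiceType := orbits phi in
  let S_fin : choiceType := finite_orbits phi in
  let H2 : zmodType :=
    (tensor (augmentation_kernel S) {freeg S} * {freeg S_fin})%type in
  [/\ HR phi 0 ≅ int,
      HR phi 1 ≅ {freeg S} /\ {freeg S} ≅ {freeg r}
    & HR phi 2 ≅ H2 /\ H2 ≅ {freeg (r * r_pred + r_fin)%type}].
Proof.
move=> S S_fin H2; have phi_inj := bij_inj phi_bij.
have [fr frb] : exists f : r -> S, bijective f.
  (* [card_setT_sym] passes from the set [orbits phi] to the full set of the type of its
     elements. *)
  by apply: card_eq_setT; apply: card_eq_trans card_r (card_setT_sym _).
have [ff ffb] : exists f : r_fin -> S_fin, bijective f.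
  by apply: card_eq_setT; apply: card_eq_trans card_r_fin (card_setT_sym _).
have [fr' frK fr'K] := frb; have [ff' ffK ff'K] := ffb.
split; first exact: HR0_iso.
  by split; [exact: HR1_iso | apply: zmod_iso_sym; apply: zmod_iso_freeg_bij frb].
(* [Q] indexes a basis of the augmentation kernel. It is not always [r_pred], so the comparison with
   [r * r_pred] is a separate requirement. *)
suff [Q [HRQ AQ [k kb]]] : exists Q : choiceType,
    [/\ HR phi 2 ≅ {freeg (Q * S + S_fin)%type}, augmentation_kernel S ≅ {freeg Q} &
     exists k : Q * S -> r * r_pred, bijective k].
  have H2Q : H2 ≅ {freeg (Q * S + S_fin)%type}.
    apply: zmod_iso_trans (zmod_iso_freeg_sum _ _).
    apply: zmod_iso_prod; last by exists idfun; exists id.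
    by apply: tensor_freeg => //; exists idfun; exists id.
  split; first by apply: zmod_iso_trans HRQ _; apply: zmod_iso_sym.
  apply: (zmod_iso_trans H2Q).
  have [k' kK k'K] := kb.
  apply: (@zmod_iso_freeg_bij _ _ (fun z =>
    match z with inl a => inl (k a) | inr b => inr (ff' b) end)).
  exists (fun z => match z with inl a => inl (k' a) | inr b => inr (ff b) end).
    by case=> a; rewrite ?kK ?ff'K.
  by case=> a; rewrite ?k'K ?ffK.
(* When there are no orbits, [card_pred] says nothing about [r_pred], which may be nonempty. Then
   [Q := S] is empty, and so are both products. *)
have [S0|[s0]] : (S -> False) \/ inhabited S.
  by have [h|h] := pselect (inhabited S); [right|left => s; apply: h].
  have X0 (x : X) : False by apply: S0; exact: orbit_class x.
  exists S; split.
  - apply: homology_trivial; apply: freeg_empty.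
      by move=> t; apply: X0 (thead t).
    case=> [[/S0] //|o]; have [[x _ _] _] := set_mem (valP o); exact: X0 x.
  - apply: zmod_iso_trivial => [z|]; last exact: freeg_empty.
    by apply: val_inj; apply: freeg_empty.
  - exists (fun z => match S0 z.1 with end).
    by exists (fun z => match S0 (fr z.1) with end) => z; [case: (S0 z.1)|case: (S0 (fr z.1))].
(* For infinite [r], [r_pred] has the cardinality of [r] and absorbs the extra point. Composed with
   [fr], this gives the indexing of orbits with a base orbit. *)
have [g gb] : exists g : option r_pred -> r, bijective g.
  have [rinf rfin] := card_r_pred; apply: card_eq_setT.
  have [r_fin'|r_inf] := pselect (finite_set [set: r]).
    by apply: rfin => //; exists (fr' s0).
  apply: card_eq_trans (rinf r_inf); apply: card_eq_option.
  by rewrite /= (eq_finite_set (rinf r_inf)).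
exists r_pred; split.
- exact: (HR2_iso phi_bij (bij_comp frb gb)).
- exact: (augmentation_kernel_freeg (bij_comp frb gb)).
- exists (fun z => (fr' z.2, z.1)); exists (fun z => (z.2, fr z.1)) => -[a b] /=.
    by rewrite fr'K.
  by rewrite frK.
Qed.
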